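(* A skew lattice $S$ is a left distributive solution of the Yang–Baxter equation if and only if $S$ is distributive and left cancellative.
   Context: A skew lattice is a set $S$ with two binary operations $\wedge,\vee$, each idempotent and associative, satisfying the absorption laws $x\wedge(x\vee y)=x=x\vee(x\wedge y)$ and $(x\wedge y)\vee y=y=(x\vee y)\wedge y$ for all $x,y\in S$. $S$ is distributive if it satisfies $x\wedge(y\vee z)\wedge x=(x\wedge y\wedge x)\vee(x\wedge z\wedge x)$ and $x\vee(y\wedge z)\vee x=(x\vee y\vee x)\wedge(x\vee z\vee x)$. $S$ is left cancellative if ($x\vee y=x\vee z$ and $x\wedge y=x\wedge z$) $\Rightarrow y=z$. $S$ is a left distributive solution if $r_L(x,y)=(x\wedge y,y\vee x)$ satisfies $(r_L\times\mathrm{id})\circ(\mathrm{id}\times r_L)\circ(r_L\times\mathrm{id})=(\mathrm{id}\times r_L)\circ(r_L\times\mathrm{id})\circ(\mathrm{id}\times r_L)$. *)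

(* Defs.v *)
Definition is_skew_lattice {S : Type} (meet join : S -> S -> S) : Prop :=
  (forall x, meet x x = x) /\ (forall x, join x x = x) /\
  (forall x y z, meet x (meet y z) = meet (meet x y) z) /\
  (forall x y z, join x (join y z) = join (join x y) z) /\
  (forall x y, meet x (join x y) = x) /\
  (forall x y, join x (meet x y) = x) /\
  (forall x y, join (meet x y) y = y) /\
  (forall x y, meet (join x y) y = y).

Definition skew_distributive {S : Type} (meet join : S -> S -> S) : Prop :=
  (forall x y z,
     meet (meet x (join y z)) x = join (meet (meet x y) x) (meet (meet x z) x)) /\
  (forall x y z,
     join (join x (meet y z)) x = meet (join (join x y) x) (join (join x z) x)).

Definition left_cancellative {S : Type} (meet join : S -> S -> S) : Prop :=
  forall x y z, join x y = join x z -> meet x y = meet x z -> y = z.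

Definition rL {S : Type} (meet join : S -> S -> S) (p : S * S) : S * S :=
  (meet (fst p) (snd p), join (snd p) (fst p)).

Definition r12 {S : Type} (r : S * S -> S * S) (t : S * S * S) : S * S * S :=
  let '(x, y, z) := t in let '(a, b) := r (x, y) in (a, b, z).
Definition r23 {S : Type} (r : S * S -> S * S) (t : S * S * S) : S * S * S :=
  let '(x, y, z) := t in let '(b, c) := r (y, z) in (x, b, c).

Definition braided {S : Type} (r : S * S -> S * S) : Prop :=
  forall t, r12 r (r23 r (r12 r t)) = r23 r (r12 r (r23 r t)).

Definition left_distributive_solution {S : Type} (meet join : S -> S -> S) : Prop :=
  braided (rL meet join).

(* Main.v *)
(** Green's relations L and R are congruences on a skew lattice S, they intersect in equality,
S/L is right-handed ([x ⊓ y ⊓ x = y ⊓ x], [x ⊔ y ⊔ x = x ⊔ y]) and S/R is left-handed.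
Exchanging meet and join exchanges L and R, and maps the braid identity
[((b ⊔ a) ⊓ c) ⊔ (a ⊓ b) = ((b ⊓ c) ⊔ a) ⊓ (c ⊔ b)] to itself with [a] and [c] exchanged.
Hence it suffices to prove the theorem for right-handed skew lattices. There, for [c ≤ b], the
braid identity is the modular law [c ⊔ (a ⊓ b) = (c ⊔ a) ⊓ b], which gives both distributive laws.
Conversely, [c] has the same join with both sides of the braid identity, and left cancellation,
applied to an auxiliary element [z], shows that it also has the same meet.
To avoid quotient types, right-handed skew lattices are taken modulo a congruence. *)

From Stdlib Require Import Setoid Morphisms.
Require Import Defs.

(** * Right-handed skew lattices modulo a congruence *)

Record right_handed_mod {S : Type} (eqv : S -> S -> Prop) (meet join : S -> S -> S) : Prop := {
  rh_equiv : Equivalence eqv;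
  rh_meet_proper : Proper (eqv ==> eqv ==> eqv) meet;
  rh_join_proper : Proper (eqv ==> eqv ==> eqv) join;
  rh_meet_idem : forall x, eqv (meet x x) x;
  rh_join_idem : forall x, eqv (join x x) x;
  rh_meetA : forall x y z, eqv (meet x (meet y z)) (meet (meet x y) z);
  rh_joinA : forall x y z, eqv (join x (join y z)) (join (join x y) z);
  rh_meet_join : forall x y, eqv (meet x (join x y)) x;
  rh_join_meet : forall x y, eqv (join x (meet x y)) x;
  rh_meet_join_r : forall x y, eqv (join (meet x y) y) y;
  rh_join_meet_r : forall x y, eqv (meet (join x y) y) y;
  rh_meet : forall x y, eqv (meet (meet x y) x) (meet y x);
  rh_join : forall x y, eqv (join (join x y) x) (join x y)
}.

(* The middle component of the braid relation; the outer two hold in every skew lattice. *)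
Definition yang_baxter_mod {S : Type} (eqv : S -> S -> Prop) (meet join : S -> S -> S) : Prop :=
  forall a b c, eqv (join (meet (join b a) c) (meet a b)) (meet (join (meet b c) a) (join c b)).

Definition left_cancellative_mod {S : Type} (eqv : S -> S -> Prop) (meet join : S -> S -> S) : Prop :=
  forall x y z, eqv (join x y) (join x z) -> eqv (meet x y) (meet x z) -> eqv y z.

(* In the right-handed case the two laws of [skew_distributive] reduce to these one-sided ones. *)
Definition meet_distr_mod {S : Type} (eqv : S -> S -> Prop) (meet join : S -> S -> S) : Prop :=
  forall x y z, eqv (meet (join y z) x) (join (meet y x) (meet z x)).
Definition join_distr_mod {S : Type} (eqv : S -> S -> Prop) (meet join : S -> S -> S) : Prop :=
  forall x y z, eqv (join x (meet y z)) (meet (join x y) (join x z)).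

(* The preorder whose classes are the D-classes: for a right-handed skew lattice it is one-sided. *)
Definition below_mod {S : Type} (eqv : S -> S -> Prop) (meet : S -> S -> S) (y x : S) : Prop :=
  eqv (meet x y) y.

Definition skew_distributive_mod {S : Type} (eqv : S -> S -> Prop) (meet join : S -> S -> S) : Prop :=
  (forall x y z, eqv (meet (meet x (join y z)) x) (join (meet (meet x y) x) (meet (meet x z) x))) /\
  (forall x y z, eqv (join (join x (meet y z)) x) (meet (join (join x y) x) (join (join x z) x))).

Section RightHanded.

Context {S : Type} {eqv : S -> S -> Prop} {meet join : S -> S -> S}.
Hypothesis RH : right_handed_mod eqv meet join.

Local Infix "==" := eqv (at level 70).
Local Infix "⊓" := meet (at level 40, left associativity).
Local Infix "⊔" := join (at level 50, left associativity).

Local Instance eqv_equivalence : Equivalence eqv := rh_equiv _ _ _ RH.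
Local Instance meet_proper : Proper (eqv ==> eqv ==> eqv) meet := rh_meet_proper _ _ _ RH.
Local Instance join_proper : Proper (eqv ==> eqv ==> eqv) join := rh_join_proper _ _ _ RH.

Let meet_idem := rh_meet_idem _ _ _ RH.
Let join_idem := rh_join_idem _ _ _ RH.
Let meetA := rh_meetA _ _ _ RH.
Let joinA := rh_joinA _ _ _ RH.
Let meet_join := rh_meet_join _ _ _ RH.
Let join_meet := rh_join_meet _ _ _ RH.
Let meet_join_r := rh_meet_join_r _ _ _ RH.
Let join_meet_r := rh_join_meet_r _ _ _ RH.
Let rmeet := rh_meet _ _ _ RH.
Let rjoin := rh_join _ _ _ RH.

Local Notation below := (below_mod eqv meet).

Lemma below_join x y : below y x -> x ⊔ y == x.
Proof. unfold below_mod; intros H; rewrite <- H; apply join_meet. Qed.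

Lemma join_below x y : x ⊔ y == x -> below y x.
Proof. unfold below_mod; intros H; rewrite <- H at 1; apply join_meet_r. Qed.

Lemma below_refl x : below x x.
Proof. apply meet_idem. Qed.

Lemma below_trans x y z : below x y -> below y z -> below x z.
Proof. unfold below_mod; intros H1 H2; rewrite <- H1, meetA, H2; reflexivity. Qed.

Lemma meet_below_l x y z : below x z -> below (x ⊓ y) z.
Proof. unfold below_mod; intros H; rewrite meetA, H; reflexivity. Qed.

Lemma meet_below_r x y z : below y z -> below (x ⊓ y) z.
Proof.
intros H; apply below_trans with y; trivial.
unfold below_mod; rewrite meetA; apply rmeet.
Qed.

Lemma below_join_l x y z : below z x -> below z (x ⊔ y).
Proof. intros H; apply below_trans with x; trivial. apply join_below, rjoin. Qed.

Lemma below_join_r x y z : below z y -> below z (x ⊔ y).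
Proof. intros H; apply below_trans with y; trivial. apply join_meet_r. Qed.

Lemma join_lub x y z : below x z -> below y z -> below (x ⊔ y) z.
Proof.
intros Hx Hy; apply join_below.
rewrite joinA, (below_join _ _ Hx); apply below_join, Hy.
Qed.

Lemma meet_glb x y z : below z x -> below z y -> below z (x ⊓ y).
Proof. unfold below_mod; intros Hx Hy; rewrite <- meetA, Hy; exact Hx. Qed.

Lemma le_below x y : x ⊓ y == x -> below x y.
Proof. unfold below_mod; intros H; rewrite <- H, meetA; apply rmeet. Qed.

Local Hint Resolve below_refl meet_glb join_lub : below.
Local Hint Extern 2 (below (_ ⊓ _) _) => apply meet_below_l : below.
Local Hint Extern 2 (below (_ ⊓ _) _) => apply meet_below_r : below.
Local Hint Extern 2 (below _ (_ ⊔ _)) => apply below_join_l : below.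
Local Hint Extern 2 (below _ (_ ⊔ _)) => apply below_join_r : below.

(** The D-classes form a lattice, so the inequalities below that concern only D-classes yield to a
    search with the bounds above. *)
Ltac below := auto 12 with below nocore.

Local Instance below_proper : Proper (eqv ==> eqv ==> iff) below.
Proof.
intros y y' Hy x x' Hx; unfold below_mod; rewrite Hy, Hx; reflexivity.
Qed.

Lemma below_meet x y : below y x -> x ⊓ y == y.
Proof. trivial. Qed.

(** Write [u] for the join and [w] for its left factor [(b ⊔ a) ⊓ c]. Then [c ⊓ u] lies below [w],
    so it equals [w ⊓ (c ⊓ u) = w ⊓ u = w]. *)
Lemma meet_braid_left a b c :
  c ⊓ (((b ⊔ a) ⊓ c) ⊔ (a ⊓ b)) == (b ⊔ a) ⊓ c.
Proof.
set (u := ((b ⊔ a) ⊓ c) ⊔ (a ⊓ b)).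
assert (H : below (c ⊓ u) ((b ⊔ a) ⊓ c)) by (unfold u; below).
rewrite <- (below_meet _ _ H), meetA, <- (meetA _ c c), meet_idem.
unfold u; apply meet_join.
Qed.

Lemma join_braid_left a b c :
  c ⊔ (((b ⊔ a) ⊓ c) ⊔ (a ⊓ b)) == c ⊔ (a ⊓ b).
Proof.
rewrite joinA.
assert (H : below ((b ⊔ a) ⊓ c) c) by below.
rewrite (below_join _ _ H); reflexivity.
Qed.

(** * From the braid identity to distributivity and cancellation *)

Section YangBaxter.

Hypothesis YB : yang_baxter_mod eqv meet join.

Lemma yang_baxter_modular a b c :
  c ⊓ b == c -> c ⊔ (a ⊓ b) == (c ⊔ a) ⊓ b.
Proof.
intros H.
assert (Hcb := le_below _ _ H).
assert (Hca : below c (b ⊔ a)) by below.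
assert (E := YB a b c).
rewrite (below_meet _ _ Hca), (below_meet _ _ Hcb) in E; rewrite E.
rewrite <- H at 2; rewrite meet_join_r; reflexivity.
Qed.

Lemma yang_baxter_meet_distr : meet_distr_mod eqv meet join.
Proof.
intros c b a.
(* Meeting the braid identity with [c] on the right replaces [b] by [b ⊓ c], to which the modular
   law applies. *)
assert (E : (b ⊔ a) ⊓ c == ((b ⊓ c) ⊔ a) ⊓ c).
{ rewrite <- (meet_idem c) at 1.
  rewrite meetA, <- (meet_braid_left a b c), rmeet, (YB a b c), <- meetA.
  assert (H : below c (c ⊔ b)) by below.
  rewrite (below_meet _ _ H); reflexivity. }
rewrite E; symmetry; apply yang_baxter_modular.
rewrite <- meetA, meet_idem; reflexivity.
Qed.

(** Join the braid identity with [c] on the left: the modular law applies because [c ≤ c ⊔ b], and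
    [c] absorbs [b ⊓ c]. *)
Lemma yang_baxter_join_distr : join_distr_mod eqv meet join.
Proof.
intros c a b.
rewrite <- (join_braid_left a b c), (YB a b c), yang_baxter_modular by apply meet_join.
assert (H : below (b ⊓ c) c) by below.
rewrite joinA, (below_join _ _ H); reflexivity.
Qed.

End YangBaxter.

(** Expanding [y = (x ⊔ y) ⊓ y = (x ⊔ z) ⊓ y] gives [(x ⊓ z) ⊔ (z ⊓ y)], and both terms lie below
    [z]. By symmetry [y] and [z] are D-equivalent. *)
Lemma meet_distr_cancel_below x y z : meet_distr_mod eqv meet join ->
  x ⊔ y == x ⊔ z -> x ⊓ y == x ⊓ z -> below y z.
Proof.
intros D Hj Hm; unfold meet_distr_mod in D.
assert (E : y == (x ⊓ z) ⊔ (z ⊓ y)).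
{ rewrite <- Hm, <- D, <- Hj; symmetry; apply join_meet_r. }
assert (H : below ((x ⊓ z) ⊔ (z ⊓ y)) z) by below.
unfold below_mod in *; rewrite E at 1; rewrite H; symmetry; exact E.
Qed.

Lemma yang_baxter_left_cancellative :
  yang_baxter_mod eqv meet join -> left_cancellative_mod eqv meet join.
Proof.
intros YB x y z Hj Hm.
assert (D := yang_baxter_meet_distr YB).
assert (Hyz := meet_distr_cancel_below _ _ _ D Hj Hm).
assert (Hzy := meet_distr_cancel_below _ _ _ D (symmetry Hj) (symmetry Hm)).
assert (Hd : y ⊓ x == z ⊓ x) by (rewrite <- (rmeet x y), Hm; apply rmeet).
(* With [s = z ⊓ x], D-equivalence of [y] and [z] reduces these to: each of [s ⊔ y] and [s ⊔ z] is
   the other met with [x ⊔ z]. Hence they are equal. *)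
assert (E1 := YB y z x); assert (E2 := YB z y x).
rewrite (below_join _ _ Hyz), (below_meet _ _ Hzy) in E1.
rewrite (below_join _ _ Hzy), (below_meet _ _ Hyz), Hd, Hj in E2.
assert (E : (z ⊓ x) ⊔ y == (z ⊓ x) ⊔ z).
{ rewrite E2, E1, <- meetA, meet_idem; reflexivity. }
assert (F : below (z ⊓ x) (x ⊓ z)) by below.
rewrite <- (meet_join_r x y), Hm, <- (below_join _ _ F), <- joinA, E, joinA,
  (below_join _ _ F).
apply meet_join_r.
Qed.

(** * From distributivity and cancellation to the braid identity *)

Section Distributive.

Hypothesis DM : meet_distr_mod eqv meet join.
Hypothesis DJ : join_distr_mod eqv meet join.
Hypothesis LC : left_cancellative_mod eqv meet join.

(** Cancel [z]: both [c ⊓ v] and [v ⊓ c] have join [z ⊔ v] and meet [p] with it. *)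
Lemma relative_complement_commute p z c v :
  p ⊓ z == p -> p ⊓ c == p -> p ⊓ v == p -> below (c ⊓ z) p ->
  v ⊓ (z ⊔ c) == v -> c ⊓ v == v ⊓ c.
Proof.
intros Hz Hc Hv Hcz Hm; unfold meet_distr_mod, join_distr_mod in *.
assert (Hvm := le_below _ _ Hm).
assert (Hzc : below (z ⊓ c) p)
  by (apply below_trans with (c ⊓ z); trivial; below).
apply LC with z.
- rewrite !DJ.
  assert (H : below (z ⊔ v) (z ⊔ c)) by below.
  rewrite (below_meet _ _ H), DM, Hm, meet_join; reflexivity.
- assert (H1 : below (z ⊓ (c ⊓ v)) p)
    by (rewrite meetA; apply meet_below_l; trivial).
  assert (H2 : below (z ⊓ (v ⊓ c)) p)
    by (apply below_trans with (z ⊓ c); trivial; below).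
  rewrite <- (below_meet _ _ H1), <- (below_meet _ _ H2), !meetA, !Hz, Hc, Hv, Hc; reflexivity.
Qed.

Lemma distributive_yang_baxter : yang_baxter_mod eqv meet join.
Proof.
intros a b c; unfold meet_distr_mod, join_distr_mod in *.
set (p := b ⊓ c); set (m := c ⊔ b); set (v := (p ⊔ a) ⊓ m).
(* [z] is [b] moved within its D-class so that [p ⊓ z = p] and [z ⊔ c = m] hold exactly: a
   complement of [c] between [p] and [m]. *)
set (z := p ⊔ (b ⊓ m)).
assert (Hpc : p ⊓ c == p) by (unfold p; rewrite <- meetA, meet_idem; reflexivity).
assert (Hpm : p ⊓ m == p) by (unfold p, m; rewrite <- meetA, meet_join; reflexivity).
assert (Hcm : c ⊓ m == c) by apply meet_join.
assert (Hz : z ⊔ c == m).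
{ assert (H : below m (z ⊔ c)) by (unfold z, m; below).
  rewrite <- (below_meet _ _ H); unfold z at 2.
  rewrite !DM, Hpm, <- meetA, meet_idem, Hcm; reflexivity. }
(* [DM] expands a meet only when [c] stands on the right. *)
assert (C : c ⊓ v == v ⊓ c).
{ apply relative_complement_commute with p z.
  - apply meet_join.
  - exact Hpc.
  - unfold v; rewrite meetA, meet_join; exact Hpm.
  - unfold z, p; below.
  - rewrite Hz; unfold v; rewrite <- meetA, meet_idem; reflexivity. }
apply LC with c.
- rewrite join_braid_left, DJ; unfold v; rewrite DJ; unfold m.
  assert (H : below p c) by (unfold p; below).
  rewrite !joinA, (below_join _ _ H), join_idem; reflexivity.
- rewrite meet_braid_left, C; unfold v.
  assert (H : below c m) by (unfold m; below).
  rewrite <- meetA, (below_meet _ _ H), !DM, Hpc; reflexivity.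
Qed.

End Distributive.

Lemma skew_distributive_mod_one_sided :
  skew_distributive_mod eqv meet join <->
  meet_distr_mod eqv meet join /\ join_distr_mod eqv meet join.
Proof.
unfold skew_distributive_mod, meet_distr_mod, join_distr_mod.
split; intros [DM DJ]; split; intros x y z.
- rewrite <- rmeet, DM, !rmeet; reflexivity.
- rewrite <- rjoin, DJ, !rjoin; reflexivity.
- rewrite !rmeet; apply DM.
- rewrite !rjoin; apply DJ.
Qed.

End RightHanded.

(** * Green's relations and the quotient by L *)

Definition green_L {S : Type} (op : S -> S -> S) (x y : S) : Prop := op x y = x /\ op y x = y.

Lemma green_L_equivalence {S : Type} (op : S -> S -> S) :
  (forall x, op x x = x) -> (forall x y z, op x (op y z) = op (op x y) z) ->
  Equivalence (green_L op).
Proof.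
intros I A; split.
- split; apply I.
- intros x y [H1 H2]; split; trivial.
- intros x y z [H1 H2] [H3 H4]; split.
  + rewrite <- H1, <- A, H3; reflexivity.
  + rewrite <- H4, <- A, H2; reflexivity.
Qed.

Lemma green_L_proper {S : Type} (op : S -> S -> S) :
  (forall x, op x x = x) -> (forall x y z, op x (op y z) = op (op x y) z) ->
  (forall x y z, op (op (op (op x y) x) z) x = op (op (op x y) z) x) ->
  Proper (green_L op ==> green_L op ==> green_L op) op.
Proof.
intros I A Reg.
assert (Hl : forall t x y, green_L op x y -> op (op x t) (op y t) = op x t).
{ intros t x y [H1 H2].
  rewrite <- H1, <- !A, (A y t), I; reflexivity. }
(* In any band L is compatible with multiplication on the right; on the left this takes
   regularity. *)
assert (Hr : forall t x y, green_L op x y -> op (op t x) (op t y) = op t x).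
{ intros t x y [H1 H2].
  assert (H : op (op x t) y = op (op x t) x).
  { rewrite <- H2, A, <- Reg, <- (A _ y x), H2, <- (A _ x y), H1; reflexivity. }
  rewrite <- A, (A x), H, <- A, A, I; reflexivity. }
intros x y H x' y' H'.
pose proof (green_L_equivalence op I A) as EQ.
assert (Hs := symmetry H); assert (Hs' := symmetry H').
transitivity (op y x').
- split; apply Hl; trivial.
- split; apply Hr; trivial.
Qed.

Lemma skew_lattice_dual {S : Type} (meet join : S -> S -> S) :
  is_skew_lattice meet join -> is_skew_lattice join meet.
Proof. unfold is_skew_lattice; intuition. Qed.

Lemma skew_lattice_opposite {S : Type} (meet join : S -> S -> S) :
  is_skew_lattice meet join ->
  is_skew_lattice (fun x y => meet y x) (fun x y => join y x).
Proof. unfold is_skew_lattice; intuition auto. Qed.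

Section SkewLattice.

Context {S : Type} {meet join : S -> S -> S}.
Hypothesis SL : is_skew_lattice meet join.

Local Infix "⊓" := meet (at level 40, left associativity).
Local Infix "⊔" := join (at level 50, left associativity).

(* With [p = x ⊓ y] and [q = z ⊓ x], the factors of [x = (p ⊔ x) ⊓ (x ⊔ q)] are absorbed by [p] and [q], so [p ⊓ x ⊓ q = p ⊓ q]. *)
Lemma meet_regular x y z : x ⊓ y ⊓ x ⊓ z ⊓ x = x ⊓ y ⊓ z ⊓ x.
Proof.
destruct SL as (mI & jI & mA & jA & mj & jm & mjr & jmr).
set (p := x ⊓ y); set (q := z ⊓ x).
assert (Hp : x ⊔ p = x) by apply jm.
assert (Hq : q ⊔ x = x) by apply mjr.
assert (Hxa : x ⊓ (p ⊔ x) = p ⊔ x).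
{ assert (H : x ⊔ (p ⊔ x) = x) by (rewrite jA, Hp; apply jI).
  rewrite <- H at 1; apply jmr. }
assert (Hbx : (x ⊔ q) ⊓ x = x ⊔ q).
{ assert (H : (x ⊔ q) ⊔ x = x) by (rewrite <- jA, Hq; apply jI).
  rewrite <- H at 2; apply mj. }
assert (Ha : (p ⊔ x) ⊓ (x ⊔ q) ⊓ (p ⊔ x) = p ⊔ x).
{ assert (E : p ⊔ x = x ⊓ (x ⊔ q) ⊓ (p ⊔ x)) by (rewrite mj, Hxa; reflexivity).
  rewrite <- mA; rewrite E at 1; rewrite <- !mA, (mA (x ⊔ q) (p ⊔ x)), mI, mA.
  symmetry; exact E. }
assert (Hx : (p ⊔ x) ⊓ (x ⊔ q) = x).
{ assert (E : (p ⊔ x) ⊓ (x ⊔ q) = (p ⊔ x) ⊓ (x ⊔ q) ⊓ (p ⊔ x) ⊓ x)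
    by (rewrite <- (mA _ (p ⊔ x) x), jmr, <- mA, Hbx; reflexivity).
  rewrite E, Ha; apply jmr. }
change (p ⊓ x ⊓ z ⊓ x = p ⊓ z ⊓ x).
rewrite <- !mA; fold q.
rewrite <- Hx at 1.
rewrite <- mA, jmr, mA, mj; reflexivity.
Qed.

End SkewLattice.

Section Quotient.

Context {S : Type} {meet join : S -> S -> S}.
Hypothesis SL : is_skew_lattice meet join.

Local Infix "⊓" := meet (at level 40, left associativity).
Local Infix "⊔" := join (at level 50, left associativity).

(** This transfers compatibility to [join], as L for its opposite. *)
Lemma green_L_meet_join x y : green_L meet x y <-> green_L (fun u v => v ⊔ u) x y.
Proof.
destruct SL as (mI & jI & mA & jA & mj & jm & mjr & jmr).
unfold green_L; split; intros [H1 H2]; split.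
- rewrite <- H2 at 1; apply mjr.
- rewrite <- H1 at 1; apply mjr.
- rewrite <- H2 at 1; apply mj.
- rewrite <- H1 at 1; apply mj.
Qed.

Lemma green_L_right_handed : right_handed_mod (green_L meet) meet join.
Proof.
assert (Reg := @meet_regular _ _ _ SL).
assert (RegJ := @meet_regular _ _ _ (skew_lattice_opposite _ _ (skew_lattice_dual _ _ SL))).
pose proof SL as (mI & jI & mA & jA & mj & jm & mjr & jmr).
assert (EQ := green_L_equivalence meet mI mA).
split; trivial; intros;
  try (match goal with |- green_L _ ?a ?b => replace a with b by auto; reflexivity end).
- apply green_L_proper; trivial.
- intros x y H x' y' H'; apply green_L_meet_join; rewrite green_L_meet_join in H, H'.
  apply (green_L_proper (fun u v => v ⊔ u)); auto.
- split; rewrite !mA; repeat rewrite <- (mA _ x x), mI.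
  + rewrite <- !mA, (mA x y (x ⊓ (y ⊓ x))), (mA x y x), mA, mI; reflexivity.
  + rewrite <- !mA, (mA y x (y ⊓ x)), mI; reflexivity.
- apply green_L_meet_join; split.
  + rewrite !jA, <- (jA _ x y), jI; reflexivity.
  + rewrite !jA, <- (jA _ x x), jI, <- (jA _ x y), jI; reflexivity.
Qed.

(** By absorption [green_L join] is Green's R for [meet], so equations can be checked modulo L and
    modulo R separately. *)
Lemma green_L_join_eq x y : green_L meet x y -> green_L join x y -> x = y.
Proof.
destruct SL as (mI & jI & mA & jA & mj & jm & mjr & jmr).
intros [H1 H2] [H3 H4].
rewrite <- H2, <- H4; symmetry; apply jmr.
Qed.

End Quotient.

(** * Transfer between a skew lattice and its quotients *)

Section YangBaxterSkewLattice.

Context {S : Type} {meet join : S -> S -> S}.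
Hypothesis SL : is_skew_lattice meet join.

Lemma left_distributive_solution_iff :
  left_distributive_solution meet join <-> yang_baxter_mod eq meet join.
Proof.
destruct SL as (mI & jI & mA & jA & mj & jm & mjr & jmr).
assert (E1 : forall x y z, meet (meet x y) (meet (join y x) z) = meet x (meet y z))
  by (intros x y z; rewrite mA, <- (mA x y (join y x)), mj, mA; reflexivity).
assert (E3 : forall x y z, join (join z y) (join (meet y z) x) = join z (join y x))
  by (intros; rewrite jA, <- (jA z y (meet y z)), jm, jA; reflexivity).
split.
- intros H x y z; specialize (H (x, y, z)); injection H; auto.
- intros H [[x y] z]; simpl; rewrite E1, E3; do 2 f_equal; apply H.
Qed.

Lemma skew_distributive_mod_green_L :
  skew_distributive meet join ->
  meet_distr_mod (green_L meet) meet join /\ join_distr_mod (green_L meet) meet join.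
Proof.
intros [DM DJ].
assert (RH := green_L_right_handed SL).
assert (EQ := rh_equiv _ _ _ RH).
apply (skew_distributive_mod_one_sided RH).
split; intros x y z; [rewrite DM | rewrite DJ]; reflexivity.
Qed.

Lemma yang_baxter_green_L :
  yang_baxter_mod eq meet join ->
  skew_distributive_mod (green_L meet) meet join /\
  left_cancellative_mod (green_L meet) meet join.
Proof.
intros YB.
assert (RH := green_L_right_handed SL).
assert (EQ := rh_equiv _ _ _ RH).
assert (YBL : yang_baxter_mod (green_L meet) meet join)
  by (intros a b c; rewrite YB; reflexivity).
split.
- apply (skew_distributive_mod_one_sided RH); split.
  + apply (yang_baxter_meet_distr RH YBL).
  + apply (yang_baxter_join_distr RH YBL).
- apply (yang_baxter_left_cancellative RH YBL).
Qed.

(** An implication need not descend to a quotient. Distributivity first makes [y] and [z]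
    D-equivalent, so that [meet y z] is R-related to [y] and L-related to [z]. *)
Lemma left_cancellative_green_L :
  skew_distributive meet join -> left_cancellative meet join ->
  left_cancellative_mod (green_L meet) meet join.
Proof.
intros D LC x y z Hj Hm.
assert (RH := green_L_right_handed SL).
assert (RH' := green_L_right_handed (skew_lattice_dual _ _ SL)).
assert (EQ := rh_equiv _ _ _ RH); assert (EQ' := rh_equiv _ _ _ RH').
assert (PM := rh_meet_proper _ _ _ RH); assert (PJ := rh_join_proper _ _ _ RH).
assert (PJ' := rh_meet_proper _ _ _ RH'); assert (PM' := rh_join_proper _ _ _ RH').
assert (DM := proj1 (skew_distributive_mod_green_L D)).
destruct (meet_distr_cancel_below RH _ _ _ DM Hj Hm) as [_ Hyzy].
destruct (meet_distr_cancel_below RH _ _ _ DM (symmetry Hj) (symmetry Hm)) as [_ Hzyz].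
pose proof SL as (mI & jI & mA & jA & mj & jm & mjr & jmr).
rewrite mA in Hyzy, Hzyz.
(* In the L-class of [z], [meet y z] is the element whose meet and join with [x] are exactly those of [y]. *)
assert (HL : green_L meet (meet y z) z).
{ split; [rewrite <- mA, mI | rewrite mA]; auto. }
assert (HR : green_L join (meet y z) y).
{ split; [rewrite <- Hyzy at 2; apply jm | apply jm]. }
assert (E : y = meet y z).
{ apply LC with x; apply (green_L_join_eq SL).
  - rewrite HL; exact Hj.
  - rewrite HR; reflexivity.
  - rewrite HL; exact Hm.
  - rewrite HR; reflexivity. }
rewrite E; exact HL.
Qed.

Lemma distributive_cancellative_green_L :
  skew_distributive meet join -> left_cancellative meet join ->
  yang_baxter_mod (green_L meet) meet join.
Proof.
intros D LC.
destruct (skew_distributive_mod_green_L D) as [DM DJ].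
apply (distributive_yang_baxter (green_L_right_handed SL) DM DJ).
apply left_cancellative_green_L; trivial.
Qed.

End YangBaxterSkewLattice.

Theorem mainTheorem14 (S : Type) (meet join : S -> S -> S) :
  is_skew_lattice meet join ->
  (left_distributive_solution meet join <->
   skew_distributive meet join /\ left_cancellative meet join).
Proof.
intros SL.
assert (SL' := skew_lattice_dual _ _ SL).
assert (EQ := rh_equiv _ _ _ (green_L_right_handed SL)).
assert (EQ' := rh_equiv _ _ _ (green_L_right_handed SL')).
rewrite (left_distributive_solution_iff SL).
split.
- intros YB.
  assert (YB' : yang_baxter_mod eq join meet)
    by (intros a b c; symmetry; apply YB).
  destruct (yang_baxter_green_L SL YB) as [[DM DJ] LC].
  destruct (yang_baxter_green_L SL' YB') as [[DJ' DM'] LC'].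
  split; [split|]; intros x y z; try (apply (green_L_join_eq SL); auto; fail).
  intros Hj Hm; apply (green_L_join_eq SL).
  + apply LC with x; [rewrite Hj | rewrite Hm]; reflexivity.
  + apply LC' with x; [rewrite Hm | rewrite Hj]; reflexivity.
- intros [D LC] a b c.
  assert (D' : skew_distributive join meet) by (destruct D; split; trivial).
  assert (LC' : left_cancellative join meet)
    by (intros x y z Hm Hj; apply LC with x; trivial).
  apply (green_L_join_eq SL).
  + apply (distributive_cancellative_green_L SL D LC).
  + symmetry; apply (distributive_cancellative_green_L SL' D' LC').
Qed.
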